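(* Let $\Omega$ be a finite set with $|\Omega|=5$. Let $\mathcal{C}_5$ be the family of graphs with vertex set $\Omega$ isomorphic to the cycle $C_5$, and $\mathcal{K}_{2,3}$ the family of graphs with vertex set $\Omega$ isomorphic to the complete bipartite graph $K_{2,3}$. Then: (1) the minimal domination completions of $\mathcal{U}_{3,\Omega}$ are exactly the hypergraphs $\mathcal{D}(G)$ with $G\in\mathcal{C}_5\cup\mathcal{K}_{2,3}$; (2) $\mathcal{U}_{3,\Omega}$ has exactly $22$ minimal domination completions; (3) $\mathfrak{D}(3,\Omega)=2$, i.e. there exist minimal domination completions $\mathcal{H},\mathcal{H}'$ of $\mathcal{U}_{3,\Omega}$ with $\mathcal{U}_{3,\Omega}=\mathcal{H}\sqcap\mathcal{H}'$, and $\mathcal{U}_{3,\Omega}$ is not a domination hypergraph.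
   Context: Graphs are finite, simple, undirected; $\mathcal{D}(G)$ is the family of inclusion-minimal dominating sets of $G$ (a dominating set is $D\subseteq V(G)$ such that every vertex outside $D$ has a neighbour in $D$). A hypergraph on $\Omega$ is a nonempty family of nonempty subsets of $\Omega$, none a proper subset of another; it has ground set $\Omega$ if the union of its members is $\Omega$. A domination hypergraph is one of the form $\mathcal{D}(G)$. $\mathcal{U}_{r,\Omega}=\{A\subseteq\Omega:|A|=r\}$. $\mathcal{H}_1\leqslant\mathcal{H}_2$ means: for every $A_1\in\mathcal{H}_1$ there is $A_2\in\mathcal{H}_2$ with $A_2\subseteq A_1$. A domination completion of $\mathcal{U}_{r,\Omega}$ is a domination hypergraph $\mathcal{H}$ with ground set $\Omega$ with $\mathcal{U}_{r,\Omega}\leqslant\mathcal{H}$; minimal ones are the $\leqslant$-minimal such. $\mathcal{H}_1\sqcap\cdots\sqcap\mathcal{H}_\ell$ is the family of inclusion-minimal sets among $\{A_1\cup\cdots\cup A_\ell:A_i\in\mathcal{H}_i\}$. A $t$-decomposition of $\mathcal{U}_{r,\Omega}$ is a family of $t$ distinct domination hypergraphs with ground set $\Omega$ whose $\sqcap$ equals $\mathcal{U}_{r,\Omega}$; $\mathfrak{D}(r,\Omega)$ is the least such $t$. *)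

(* Defs.v *)
From HB Require Import structures.
From mathcomp Require Import all_boot.

Set Implicit Arguments.
Unset Strict Implicit.
Unset Printing Implicit Defensive.

(* A finite simple graph with vertex set T, given by its set of edges. *)
Record sgraph (T : finType) := SGraph {
  edges : {set {set T}};
  _ : [forall e in edges, #|e| == 2] }.

HB.instance Definition _ (T : finType) := [isSub for @edges T].
HB.instance Definition _ (T : finType) := [Finite of sgraph T by <:].

Section Graphs.
Variable T : finType.
Implicit Types (G : sgraph T) (D : {set T}) (r : rel T).

Definition adj G : rel T := fun x y => [set x; y] \in edges G.

Definition edges_of r : {set {set T}} :=
  [set e | [exists x, exists y, [&& x != y, r x y & e == [set x; y]]]].

Lemma edges_ofP r : [forall e in edges_of r, #|e| == 2].
Proof.
apply/forall_inP => e; rewrite inE.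
by case/existsP=> x /existsP[y /and3P[nxy _ /eqP->]]; rewrite cards2 nxy.
Qed.

(* The simple graph underlying r: r is symmetrised and its loops are dropped. *)
Definition graph_of_rel r : sgraph T := SGraph (edges_ofP r).

Definition dominating G : pred {set T} :=
  fun D => [forall x in ~: D, exists y in D, adj G x y].

Definition dom_hyp G : {set {set T}} := [set D | minset (dominating G) D].

End Graphs.

Definition isomorphic (T U : finType) (G : sgraph T) (K : sgraph U) : Prop :=
  exists2 f : T -> U, bijective f & forall x y, adj K (f x) (f y) = adj G x y.

Definition cycle_graph (n : nat) : sgraph 'I_n :=
  graph_of_rel (fun i j : 'I_n => j == ordS i).

Definition complete_bipartite (m n : nat) : sgraph ('I_m + 'I_n)%type :=
  graph_of_rel (fun u v : 'I_m + 'I_n =>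
    match u, v with inl _, inr _ => true | _, _ => false end).

Section Hypergraphs.
Variable T : finType.
Implicit Types (H : {set {set T}}) (t : nat).

Definition hypergraph H : bool :=
  [&& H != set0, set0 \notin H & [forall A in H, forall B in H, ~~ (A \proper B)]].

Definition has_full_ground H : bool := cover H == [set: T].

(* Only graphs with vertex set all of T are considered: since every vertex of a
   graph lies in a minimal dominating set, this is no restriction for a
   hypergraph whose ground set is T. *)
Definition domination_hypergraph H : bool :=
  hypergraph H && [exists G : sgraph T, H == dom_hyp G].

Definition hyp_le H1 H2 : bool :=
  [forall A1 in H1, exists A2 in H2, A2 \subset A1].

Definition domination_completion H0 H : bool :=
  [&& domination_hypergraph H, has_full_ground H & hyp_le H0 H].

Definition min_domination_completions H0 : {set {set {set T}}} :=
  [set H | domination_completion H0 H &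
     [forall K, (domination_completion H0 K && hyp_le K H) ==> (K == H)]].

Definition choice_unions n (Hs : n.-tuple {set {set T}}) : {set {set T}} :=
  [set \bigcup_(A <- B) A | B : n.-tuple {set T}
     & [forall i, tnth B i \in tnth Hs i]].

Definition sqcap n (Hs : n.-tuple {set {set T}}) : {set {set T}} :=
  [set A | minset [in choice_unions Hs] A].

Definition decomposition H0 t (Hs : t.-tuple {set {set T}}) : bool :=
  [&& uniq Hs,
      all (fun H => domination_hypergraph H && has_full_ground H) Hs
    & sqcap Hs == H0].

Definition is_decomposition_number H0 t : Prop :=
  (exists Hs : t.-tuple {set {set T}}, decomposition H0 Hs) /\
  (forall s (Hs : s.-tuple {set {set T}}), decomposition H0 Hs -> t <= s).

End Hypergraphs.

Definition uniform_hyp (r : nat) (T : finType) : {set {set T}} :=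
  [set A : {set T} | #|A| == r].

(* Main.v *)
(** Since a family of minimal dominating sets determines its up-closure, the
    order on domination hypergraphs is inclusion of the families of all
    dominating sets.  A domination completion of [U_3] is then [D(G)] for a graph
    [G] in which all triples are dominating.  On five vertices a graph is a
    vector of ten bits and a vertex set is a vector of five bits; through this
    encoding the statement reduces to a finite check: the 22 codes of pentagons
    and of copies of [K_{2,3}] form an antichain, and below each completion lies
    one of them.  A pentagon and its complement have no dominating pair in
    common, which gives the decomposition. *)
Require Import Defs.
From mathcomp Require Import all_boot.

Set Implicit Arguments.
Unset Strict Implicit.
Unset Printing Implicit Defensive.

(** * Minimal members of a family of sets *)

Section MinimalSets.
Variable T : finType.
Implicit Types (P Q : pred {set T}) (A B : {set T}).

(** A minimal member of [Q] contains a member of [P], which lies in [Q] as well and hence equals it.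
    This lets families be compared through their up-closures. *)
Lemma minset_upward P Q :
  (forall A, reflect (exists2 B, P B & B \subset A) (Q A)) ->
  forall A, minset P A = minset Q A.
Proof.
move=> QP A; apply/minsetP/minsetP => -[pA minA]; split.
- by apply/QP; exists A.
- move=> B /QP[C pC sCB] sBA; apply/eqP; rewrite eqEsubset sBA /=.
  by rewrite -(minA C pC (subset_trans sCB sBA)).
- by have /QP[B pB sBA] := pA; rewrite -(minA B) //; apply/QP; exists B.
- by move=> B pB; apply: minA; apply/QP; exists B.
Qed.

End MinimalSets.

(** * Dominating sets and the hypergraphs they form *)

Section Domination.
Variable T : finType.
Implicit Types (G K : sgraph T) (A B D : {set T}) (H : {set {set T}}).

Lemma adjC G x y : adj G x y = adj G y x.
Proof. by rewrite /adj setUC. Qed.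

Lemma adj_irr G x : adj G x x = false.
Proof.
apply/negP; rewrite /adj setUid => xE.
by have /forall_inP/(_ _ xE) := valP G; rewrite cards1.
Qed.

Lemma adj_graph_of_rel (r : rel T) x y :
  adj (graph_of_rel r) x y = (x != y) && (r x y || r y x).
Proof.
rewrite /adj /= inE; apply/existsP/andP => [[a /existsP[b]]|[nxy]].
  case/and3P=> nab rab /eqP exy.
  have : x \in [set a; b] by rewrite -exy set21.
  have : y \in [set a; b] by rewrite -exy set22.
  have nxy : x != y.
    by have := cards2 x y; rewrite exy cards2 nab; case: (x != y).
  rewrite !inE nxy => /orP[]/eqP ya /orP[]/eqP xa; move: nxy rab;
    rewrite ya xa ?eqxx // => _ -> //; by rewrite orbT.
case/orP=> r_; [exists x; apply/existsP; exists y|exists y; apply/existsP; exists x].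
  by rewrite nxy r_ eqxx.
by rewrite eq_sym nxy r_ setUC eqxx.
Qed.

Lemma sgraph_eqP G K : adj G =2 adj K -> G = K.
Proof.
move=> eGK; apply: val_inj; apply/setP => /= e.
have [/cards2P[x [y [_ ->]]]|ne2] := boolP (#|e| == 2); first exact: eGK.
have out G' : (e \in edges G') = false.
  by apply: contraNF ne2 => eE; have /forall_inP/(_ _ eE) := valP G'.
by rewrite !out.
Qed.

Lemma dominatingP G D :
  reflect (forall x, x \notin D -> exists2 y, y \in D & adj G x y)
          (dominating G D).
Proof.
apply: (iffP forall_inP) => domD x.
  by move=> xD; apply/exists_inP; apply: domD; rewrite inE.
by rewrite inE => /domD ?; apply/exists_inP.
Qed.

Lemma dominating_sub G A B : A \subset B -> dominating G A -> dominating G B.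
Proof.
move=> sAB /dominatingP domA; apply/dominatingP => x xB.
by have [|y /(subsetP sAB)] := domA x; [apply: contra xB; apply: (subsetP sAB)|exists y].
Qed.

Lemma dominating_dom_hypP G A :
  reflect (exists2 B, B \in dom_hyp G & B \subset A) (dominating G A).
Proof.
apply: (iffP idP) => [/minset_exists[B minB sBA]|[B]]; first by exists B; rewrite ?inE.
by rewrite inE => /minsetp domB sBA; apply: dominating_sub domB.
Qed.

Lemma hyp_le_dom_hypP H G :
  reflect (forall A, A \in H -> dominating G A) (hyp_le H (dom_hyp G)).
Proof.
apply: (iffP forall_inP) => leH A /leH.
  by move/exists_inP => ?; apply/dominating_dom_hypP.
by move/dominating_dom_hypP => ?; apply/exists_inP.
Qed.

Lemma dom_hyp_leP G K :
  reflect (forall A, dominating G A -> dominating K A)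
          (hyp_le (dom_hyp G) (dom_hyp K)).
Proof.
apply: (iffP (hyp_le_dom_hypP _ _)) => leGK A.
  by case/dominating_dom_hypP=> B /leGK domB sBA; apply: dominating_sub domB.
by rewrite inE => /minsetp /leGK.
Qed.

Lemma dom_hyp_anti G K :
  hyp_le (dom_hyp G) (dom_hyp K) -> hyp_le (dom_hyp K) (dom_hyp G) ->
  dom_hyp G = dom_hyp K.
Proof.
move=> /dom_hyp_leP leGK /dom_hyp_leP leKG.
apply/setP => A; rewrite !inE; apply: minset_eq => B.
by apply/idP/idP; [apply: leGK|apply: leKG].
Qed.

Lemma hyp_le_refl H : hyp_le H H.
Proof. by apply/forall_inP => A HA; apply/exists_inP; exists A. Qed.

(** On an empty vertex set the empty set dominates, hence the assumption that [T] is inhabited. *)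
Lemma domination_hypergraph_dom_hyp G :
  0 < #|T| -> domination_hypergraph (dom_hyp G).
Proof.
move=> /card_gt0P[x _]; apply/andP; split; last by apply/existsP; exists G.
apply/and3P; split.
- have : dominating G setT by apply/dominatingP => y; rewrite inE.
  by case/dominating_dom_hypP=> B HB _; apply/set0Pn; exists B.
- rewrite inE; apply/negP => /minsetp /dominatingP /(_ x).
  by rewrite inE => /(_ isT)[y]; rewrite inE.
- apply/forall_inP => A; rewrite inE => /minsetp domA.
  apply/forall_inP => B; rewrite inE => /minsetP[_ minB].
  apply/negP => ltAB; move: (ltAB); rewrite (minB A domA (proper_sub ltAB)).
  by rewrite properxx.
Qed.

(* The complement of the neighbourhood of x is dominating, and each dominating
   set contained in it contains x. *)
Lemma has_full_ground_dom_hyp G : has_full_ground (dom_hyp G).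
Proof.
apply/eqP/setP => x; rewrite inE; apply/bigcupP.
have /dominating_dom_hypP[B HB sB] : dominating G [set y | ~~ adj G x y].
  apply/dominatingP => y; rewrite inE negbK => xy.
  by exists x; rewrite ?inE ?adj_irr // adjC.
exists B => //; move: HB; rewrite inE => /minsetp /dominatingP domB.
apply: contraT => /domB[y /(subsetP sB)].
by rewrite inE => /negP.
Qed.

Lemma domination_completion_dom_hyp H G : 0 < #|T| ->
  domination_completion H (dom_hyp G) = hyp_le H (dom_hyp G).
Proof.
move=> T0; rewrite /domination_completion has_full_ground_dom_hyp.
by rewrite domination_hypergraph_dom_hyp.
Qed.

Lemma domination_completionE H0 H : domination_completion H0 H ->
  exists2 G, H = dom_hyp G & hyp_le H0 (dom_hyp G).
Proof.
by case/and3P=> /andP[_ /existsP[G /eqP eH]] _ le0; exists G; rewrite -?eH.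
Qed.

Lemma uniform_hypP r A :
  reflect (exists2 B, B \in uniform_hyp r T & B \subset A) (r <= #|A|).
Proof.
apply: (iffP idP) => [leA|[B]]; last by rewrite inE => /eqP <- /subset_leq_card.
have [m szm] : exists m : {set T}, (m \subset A) && (#|m| == r).
  (* The [r]-subsets of [A] are counted by a binomial coefficient, positive because [r <= #|A|]. *)
  have/card_gt0P[B] : 0 < #|[set B : {set T} | (B \subset A) & (#|B| == r)]|.
    by rewrite cards_draws bin_gt0.
  by rewrite inE; exists B.
by case/andP: szm => sm cm; exists m; rewrite ?inE.
Qed.

Lemma minset_uniform_hyp r A :
  minset (fun B : {set T} => r <= #|B|) A = (A \in uniform_hyp r T).
Proof.
rewrite -(minset_upward (P := [in uniform_hyp r T]) (uniform_hypP r)).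
apply/minsetP/idP => [[] //|uA]; split=> // B uB sBA.
apply/eqP; rewrite eqEcard sBA /=; move: uA uB; rewrite !inE.
by move=> /eqP-> /eqP->.
Qed.

(** * Meets of hypergraphs *)

Lemma choice_unions2P H1 H2 A :
  reflect (exists A1 A2, [/\ A1 \in H1, A2 \in H2 & A = A1 :|: A2])
          (A \in choice_unions [tuple H1; H2]).
Proof.
apply: (iffP imsetP) => [[B]|[A1 [A2 [h1 h2 ->]]]].
  rewrite inE => /forallP hB ->.
  exists (tnth B ord0), (tnth B (lift ord0 ord0)).
  split; [exact: (hB ord0)|exact: (hB (lift ord0 ord0))|].
  by rewrite big_tuple !big_ord_recl big_ord0 setU0.
exists [tuple A1; A2]; last by rewrite /= !big_cons big_nil setU0.
by rewrite inE; apply/forallP => -[[|[|//]] i2]; rewrite !(tnth_nth set0).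
Qed.

(** A set contains [B :|: C] exactly when it contains [B] and [C], so the up-closure of the unions
    is the intersection of the two up-closures. *)
Lemma sqcap_dom_hyp2 G K :
  sqcap [tuple dom_hyp G; dom_hyp K] =
  [set A | minset (fun B => dominating G B && dominating K B) A].
Proof.
apply/setP => A; rewrite !inE; apply: minset_upward => {}A.
apply: (iffP andP) => [[/dominating_dom_hypP[B hB sB] /dominating_dom_hypP[C hC sC]]|].
  exists (B :|: C); last by rewrite subUset sB.
  by apply/choice_unions2P; exists B, C.
case=> _ /choice_unions2P[B [C [hB hC ->]]]; rewrite subUset => /andP[sB sC].
by split; apply/dominating_dom_hypP; [exists B|exists C].
Qed.

Lemma sqcap0 (Hs : 0.-tuple {set {set T}}) : set0 \in sqcap Hs.
Proof.
rewrite inE; apply/minsetP; split=> [|B _]; last by rewrite subset0 => /eqP.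
apply/imsetP; exists [tuple]; last by rewrite big_nil.
by rewrite inE; apply/forallP => -[].
Qed.

(** The members form an antichain, so each of them is minimal. This serves to exclude decompositions
    of length one. *)
Lemma sqcap1 H : hypergraph H -> sqcap [tuple H] = H.
Proof.
case/and3P=> _ _ /forall_inP antiH.
have cuE A : (A \in choice_unions [tuple H]) = (A \in H).
  apply/imsetP/idP => [[B]|HA].
    rewrite inE => /forallP/(_ ord0); rewrite big_tuple big_ord_recl big_ord0 setU0.
    by move=> ? ->.
  exists [tuple A]; last by rewrite /= big_cons big_nil setU0.
  by rewrite inE; apply/forallP => -[[|//] i1]; rewrite !(tnth_nth set0).
apply/setP => A; rewrite inE (minset_eq A cuE); apply/minsetP/idP => [[] //|HA].
split=> // B HB sBA; apply/eqP; rewrite eqEsubset sBA /=.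
have /forall_inP/(_ A HA) := antiH B HB.
by rewrite properE sBA negbK.
Qed.

End Domination.

(** * Encoding by bit vectors *)

Fixpoint bitvecs n : seq bitseq :=
  if n is n'.+1 then
    [seq true :: s | s <- bitvecs n'] ++ [seq false :: s | s <- bitvecs n']
  else [:: [::]].

Lemma mem_bitvecs n s : (s \in bitvecs n) = (size s == n).
Proof.
elim: n s => [|n IHn] [|b s] //=; rewrite mem_cat.
  by apply/negP => /orP[]/mapP[].
have memT c : (b :: s \in [seq c :: t | t <- bitvecs n]) = (b == c) && (s \in bitvecs n).
  by apply/mapP/andP => [[t st [-> ->]]|[/eqP-> st]]; [rewrite st eqxx|exists s].
by rewrite !memT IHn eqSS; case: {memT} b; rewrite ?orbF.
Qed.

Definition vpairs : seq (nat * nat) :=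
  [:: (0, 1); (0, 2); (0, 3); (0, 4); (1, 2); (1, 3); (1, 4); (2, 3); (2, 4); (3, 4)].

(* Entry (i, j) is the position of {i, j} in vpairs; the diagonal entries are out
   of range, so that loops evaluate to the default false. *)
Definition vpair_index : seq (seq nat) :=
  [:: [:: 10; 0; 1; 2; 3]; [:: 0; 10; 4; 5; 6]; [:: 1; 4; 10; 7; 8];
      [:: 2; 5; 7; 10; 9]; [:: 3; 6; 8; 9; 10]].

Definition code_adj (c : bitseq) (i j : nat) : bool :=
  nth false c (nth 10 (nth [::] vpair_index i) j).

Definition code_dominating (c d : bitseq) : bool :=
  all (fun i => nth false d i ||
         has (fun j => nth false d j && code_adj c i j) (iota 0 5)) (iota 0 5).

(** On five vertices this amounts to every vertex having at least two neighbours. *)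
Definition code_completion (c : bitseq) : bool :=
  all (fun d => (count id d == 3) ==> code_dominating c d) (bitvecs 5).

Definition code_le (c c' : bitseq) : bool :=
  all (fun d => code_dominating c d ==> code_dominating c' d) (bitvecs 5).

(** Domination recorded for all 32 vertex sets, so that comparing two codes is a pointwise test on
    precomputed lists. *)
Definition code_table (c : bitseq) : bitseq := [seq code_dominating c d | d <- bitvecs 5].

Definition table_le : rel bitseq := all2 implb.

Lemma code_le_table c c' : code_le c c' = table_le (code_table c) (code_table c').
Proof. by rewrite /table_le all2E !size_map eqxx zip_map all_map. Qed.

(** One code for each labelling of the graph of [r]; a labelled copy recurs once for every
    automorphism. *)
Definition iso_codes (U : eqType) (u0 : U) (r : rel U) (e : seq U) : seq bitseq :=
  [seq [seq (let x := nth u0 s p.1 in let y := nth u0 s p.2 in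
             (x != y) && (r x y || r y x)) | p <- vpairs] | s <- permutations e].

Section Encoding.
Variables (T : finType) (hT : #|T| = 5) (x0 : T).
Implicit Types (G K : sgraph T) (D : {set T}) (c d : bitseq).

Let e := enum T.
Let q i := nth x0 e i.
Let size_e : size e = 5. Proof. by rewrite -cardE. Qed.
Let index_lt x : index x e < 5. Proof. by rewrite -size_e index_mem mem_enum. Qed.
Let qK x : q (index x e) = x. Proof. by rewrite /q nth_index ?mem_enum. Qed.
Let index_q i : i < 5 -> index (q i) e = i.
Proof. by move=> i5; rewrite index_uniq ?size_e ?enum_uniq. Qed.

Definition set_code D : bitseq := [seq x \in D | x <- enum T].
Definition graph_code G : bitseq :=
  [seq adj G (nth x0 (enum T) p.1) (nth x0 (enum T) p.2) | p <- vpairs].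
Definition code_set d : {set T} := [set x | nth false d (index x (enum T))].
Definition code_graph c : sgraph T :=
  graph_of_rel (fun x y => code_adj c (index x (enum T)) (index y (enum T))).

Let nth_set_code D i : i < 5 -> nth false (set_code D) i = (q i \in D).
Proof. by move=> i5; rewrite (nth_map x0) ?size_e. Qed.

(** All 25 index pairs are inspected: the diagonal reads past the tenth bit and yields [false], and
    below it adjacency is symmetric. *)
Let code_adjE G i j : i < 5 -> j < 5 ->
  code_adj (graph_code G) i j = adj G (q i) (q j).
Proof.
by move: i j => [|[|[|[|[|//]]]]] [|[|[|[|[|//]]]]] _ _;
  rewrite ?adj_irr // adjC.
Qed.

Lemma set_code_bitvecs D : set_code D \in bitvecs 5.
Proof. by rewrite mem_bitvecs size_map size_e. Qed.

Lemma code_setK d : d \in bitvecs 5 -> set_code (code_set d) = d.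
Proof.
rewrite mem_bitvecs => /eqP sz; apply: (@eq_from_nth _ false).
  by rewrite size_map size_e.
rewrite size_map size_e => i i5.
by rewrite nth_set_code // inE index_q.
Qed.

Lemma count_set_code D : count id (set_code D) = #|D|.
Proof.
rewrite count_map cardE -size_filter -(eq_filter (a1 := [in D])) //.
by rewrite /enum_mem -filter_predI; congr size; apply: eq_filter => x; rewrite /= andbT.
Qed.

Lemma graph_code_bitvecs G : graph_code G \in bitvecs 10.
Proof. by rewrite mem_bitvecs size_map. Qed.

Lemma code_graphK c : c \in bitvecs 10 -> graph_code (code_graph c) = c.
Proof.
rewrite mem_bitvecs.
have adjE i j : i < 5 -> j < 5 -> adj (code_graph c) (q i) (q j) =
    (i != j) && (code_adj c i j || code_adj c j i).
  move=> i5 j5; rewrite adj_graph_of_rel !index_q //.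
  congr (~~ _ && _); apply/eqP/eqP => [/(congr1 (index^~ e))|-> //].
  by rewrite !index_q.
rewrite /graph_code /=; rewrite !adjE //.
(* With the ten bits exposed the lookups compute; [(i, j)] and [(j, i)] read the same bit, so each
   disjunction collapses. *)
by move: c adjE => [|?[|?[|?[|?[|?[|?[|?[|?[|?[|?[]]]]]]]]]]] //= _ _;
  rewrite /code_adj /= !orbb.
Qed.

Lemma graph_codeK G : code_graph (graph_code G) = G.
Proof.
apply: sgraph_eqP => x y.
rewrite adj_graph_of_rel !code_adjE ?index_lt // !qK (adjC G y) orbb.
by case: eqP => // ->; rewrite adj_irr.
Qed.

Lemma dominating_code G D :
  dominating G D = code_dominating (graph_code G) (set_code D).
Proof.
apply/dominatingP/allP => domD.
  move=> i; rewrite mem_iota => /andP[_ i5]; rewrite nth_set_code //.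
  case: (boolP (q i \in D)) => // /domD[y yD iy]; rewrite orFb.
  apply/hasP; exists (index y e); first by rewrite mem_iota index_lt.
  by rewrite nth_set_code ?code_adjE ?index_lt // qK yD.
move=> x xD; have /domD : index x e \in iota 0 5 by rewrite mem_iota index_lt.
rewrite nth_set_code ?index_lt // qK (negPf xD) orFb => /hasP[j].
rewrite mem_iota => /= j5; rewrite nth_set_code // code_adjE ?index_lt // qK.
by case/andP; exists (q j).
Qed.

(** Every vector of length five encodes a vertex set, so a check of 32 vectors is a statement about
    all vertex sets. *)
Lemma all_bitvecs5P (P : pred bitseq) :
  reflect (forall D, P (set_code D)) (all P (bitvecs 5)).
Proof.
apply: (iffP allP) => [allP D|allP d /code_setK <- //].
by apply: allP; apply: set_code_bitvecs.
Qed.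

Lemma hyp_le_code G K :
  hyp_le (dom_hyp G) (dom_hyp K) = code_le (graph_code G) (graph_code K).
Proof.
apply/dom_hyp_leP/all_bitvecs5P => le D.
  by rewrite -!dominating_code; apply/implyP/le.
by rewrite !dominating_code; apply/implyP/le.
Qed.

Lemma completion_code G :
  domination_completion (uniform_hyp 3 T) (dom_hyp G) =
  code_completion (graph_code G).
Proof.
rewrite domination_completion_dom_hyp ?hT //.
apply/hyp_le_dom_hypP/all_bitvecs5P => le D; have := le D.
  by rewrite inE count_set_code -dominating_code => /implyP.
by rewrite inE count_set_code -dominating_code => /implyP.
Qed.

(** An isomorphism carries the enumeration of [T] to a permutation of [eU] that produces the code of
    [G]. Conversely, such a permutation [s] defines the isomorphism that sends the [i]-th vertex of
    [T] to the [i]-th entry of [s]. *)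
Lemma isomorphic_code (U : finType) (u0 : U) (r : rel U) (eU : seq U) G :
    uniq eU -> eU =i predT -> size eU = 5 ->
  isomorphic G (graph_of_rel r) <-> graph_code G \in iso_codes u0 r eU.
Proof.
move=> uU memU sU.
have lt5 p : p \in vpairs -> (p.1 < 5) && (p.2 < 5).
  by move: p; apply/allP.
split=> [[f bij_f fadj]|/mapP[s]].
  apply/mapP; exists [seq f x | x <- e].
    rewrite mem_permutations; apply: uniq_perm => //.
      by rewrite map_inj_uniq ?enum_uniq //; apply: bij_inj.
    move=> u; rewrite memU; case: bij_f => g _ gK.
    by apply/mapP; exists (g u); rewrite ?mem_enum ?gK.
  apply/eq_in_map => p /lt5/andP[p1 p2]; cbv beta zeta.
  by rewrite !(nth_map x0 u0 f) ?size_e // -fadj adj_graph_of_rel.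
rewrite mem_permutations => perm_s codeG.
have us : uniq s by rewrite (perm_uniq perm_s).
have ss : size s = 5 by rewrite (perm_size perm_s).
have ms u : u \in s by rewrite (perm_mem perm_s) memU.
exists (fun x => nth u0 s (index x e)).
  exists (fun u => q (index u s)) => [x|u].
    by rewrite index_uniq ?ss ?index_lt ?qK.
  by rewrite index_q ?nth_index // -ss index_mem.
have fadj i j : i < 5 -> j < 5 ->
    adj (graph_of_rel r) (nth u0 s i) (nth u0 s j) = adj G (q i) (q j).
  (* The code records the pairs with [a < b] only; symmetry and irreflexivity supply the others. *)
  have lt_case a b : (a, b) \in vpairs ->
      adj (graph_of_rel r) (nth u0 s a) (nth u0 s b) = adj G (q a) (q b).
    move=> ab; have := codeG; move/eq_in_map/(_ _ ab) => /= ->.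
    by rewrite adj_graph_of_rel.
  by move: i j => [|[|[|[|[|//]]]]] [|[|[|[|[|//]]]]] _ _;
    rewrite ?adj_irr //; (exact: lt_case || rewrite adjC [RHS]adjC; exact: lt_case).
by move=> x y; rewrite fadj ?index_lt // !qK.
Qed.

End Encoding.

(** * Codes of the labelled copies of [C_5] and [K_{2,3}] *)

Definition vertices_C5 : seq 'I_5 :=
  [:: @Ordinal 5 0 isT; @Ordinal 5 1 isT; @Ordinal 5 2 isT;
      @Ordinal 5 3 isT; @Ordinal 5 4 isT].

Definition vertices_K23 : seq ('I_2 + 'I_3) :=
  [:: inl (@Ordinal 2 0 isT); inl (@Ordinal 2 1 isT); inr (@Ordinal 3 0 isT);
      inr (@Ordinal 3 1 isT); inr (@Ordinal 3 2 isT)].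

Definition codes_C5 : seq bitseq :=
  iso_codes (@Ordinal 5 0 isT) (fun i j : 'I_5 => j == ordS i) vertices_C5.

Definition codes_K23 : seq bitseq :=
  iso_codes (inl (@Ordinal 2 0 isT))
    (fun u v : 'I_2 + 'I_3 =>
       match u, v with inl _, inr _ => true | _, _ => false end) vertices_K23.

Definition minimal_code_list : seq bitseq := undup (codes_C5 ++ codes_K23).

(* Locked because terminators would otherwise evaluate membership in this list. *)
Definition minimal_codes : seq bitseq := locked minimal_code_list.

Lemma mem_minimal_codes c :
  (c \in minimal_codes) = (c \in locked codes_C5) || (c \in locked codes_K23).
Proof. by rewrite /minimal_codes -!lock mem_undup mem_cat. Qed.

Lemma minimal_codes_bitvecs c : c \in minimal_codes -> c \in bitvecs 10.
Proof.
by rewrite mem_minimal_codes mem_bitvecs -!lock => /orP[]/mapP[s _ ->]; rewrite size_map.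
Qed.

Lemma uniq_minimal_codes : uniq minimal_codes.
Proof. by rewrite /minimal_codes -lock undup_uniq. Qed.

(** * The finite check *)

(** The automorphism groups have orders 10 and 12, which leaves 120/10 = 12 pentagons and 120/12 =
    10 copies of [K_{2,3}]. *)
Lemma size_minimal_codes : size minimal_codes = 22.
Proof. by rewrite /minimal_codes -lock; vm_compute. Qed.

Lemma minimal_codes_completion : all code_completion minimal_codes.
Proof. by rewrite /minimal_codes -lock; vm_compute. Qed.

(* The tables are computed once and the test is a conditional because vm_compute
   evaluates the arguments of ==> eagerly. *)
Lemma minimal_codes_anti_table :
  let L := [seq (c, code_table c) | c <- minimal_code_list] in
  all (fun p => all (fun p' => if table_le p.2 p'.2 then p.1 == p'.1 else true) L) L.
Proof. by vm_compute. Qed.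

Lemma minimal_codes_anti : {in minimal_codes &, forall c c', code_le c c' -> c = c'}.
Proof.
rewrite /minimal_codes -lock => c c' Lc Lc'; rewrite code_le_table => le_cc'.
apply/eqP.
have memL d : d \in minimal_code_list ->
    (d, code_table d) \in [seq (c, code_table c) | c <- minimal_code_list].
  by move=> Ld; apply: map_f.
have /allP/(_ _ (memL c Lc))/allP/(_ _ (memL c' Lc')) := minimal_codes_anti_table.
by rewrite le_cc'.
Qed.

(** All 1024 graphs are run through; the conditional spares the comparison for a graph that is not a
    completion. *)
Lemma minimal_codes_below_table :
  let L := [seq code_table l | l <- minimal_code_list] in
  all (fun c => if code_completion c then has (table_le^~ (code_table c)) L else true)
    (bitvecs 10).
Proof. by vm_compute. Qed.

Lemma minimal_codes_below c : c \in bitvecs 10 -> code_completion c ->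
  exists2 l, l \in minimal_codes & code_le l c.
Proof.
move=> Bc compc; have /allP/(_ c Bc) := minimal_codes_below_table.
rewrite compc has_map => /hasP[l Ll le_l].
by exists l; rewrite /minimal_codes -?lock // code_le_table.
Qed.

(** If every triple dominates, each vertex has at most two non-neighbours and so prevents at most
    one pair from dominating. Hence at least five of the ten pairs dominate. *)
Lemma no_uniform_code :
  all (fun c => ~~ all (fun d => code_dominating c d == (3 <= count id d)) (bitvecs 5))
    (bitvecs 10).
Proof. by vm_compute. Qed.

(** The cycle 0, 1, 2, 3, 4, 0, with edges in the order of [vpairs]. *)
Definition pentagon : bitseq :=
  [:: true; false; false; true; true; false; false; true; false; true].

Definition pentagram : bitseq := map negb pentagon.

Lemma pentagon_minimal : pentagon \in minimal_codes.
Proof. by rewrite /minimal_codes -lock; vm_compute. Qed.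

Lemma pentagram_minimal : pentagram \in minimal_codes.
Proof. by rewrite /minimal_codes -lock; vm_compute. Qed.

(** The dominating pairs of a pentagon are its non-edges, and those of its complement are the edges
    of the pentagon, so no pair dominates both. Triples dominate both because all degrees are
    two. *)
Lemma pentagon_pentagram :
  all (fun d => code_dominating pentagon d && code_dominating pentagram d
                == (3 <= count id d)) (bitvecs 5).
Proof. by vm_compute. Qed.

(** * Minimal completions and decompositions of [U_3] *)

Section MinimalCompletions.
Variables (T : finType) (hT : #|T| = 5) (x0 : T).
Local Notation U3 := (uniform_hyp 3 T).
Local Notation D c := (dom_hyp (code_graph T c)).

Let code_graph_of c : c \in minimal_codes -> graph_code x0 (code_graph T c) = c.
Proof. by move=> Lc; apply: code_graphK => //; apply: minimal_codes_bitvecs. Qed.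

Let le_minimal c c' : c \in minimal_codes -> c' \in minimal_codes ->
  hyp_le (D c) (D c') -> c = c'.
Proof.
move=> Lc Lc'; rewrite (hyp_le_code hT x0) !code_graph_of //.
exact: minimal_codes_anti.
Qed.

Let below_completion G : domination_completion U3 (dom_hyp G) ->
  exists2 c, c \in minimal_codes & hyp_le (D c) (dom_hyp G).
Proof.
rewrite (completion_code hT x0) => compG.
have [c Lc le_c] := minimal_codes_below (graph_code_bitvecs x0 G) compG.
by exists c; rewrite // (hyp_le_code hT x0) code_graph_of.
Qed.

Let completion_minimal c : c \in minimal_codes -> domination_completion U3 (D c).
Proof.
move=> Lc; rewrite (completion_code hT x0) code_graph_of //.
exact: (allP minimal_codes_completion).
Qed.

(** A minimal completion lies above a listed one and so equals it. Conversely, a completion below a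
    listed one lies above some listed one; the antichain property makes these two coincide, and
    antisymmetry concludes. *)
Lemma min_domination_completions_codes :
  min_domination_completions U3 =i [seq D c | c <- minimal_codes].
Proof.
move=> H; rewrite inE; apply/andP/mapP => [[compH /forall_inP minH]|[c Lc ->]].
  have [G eH _] := domination_completionE compH; rewrite eH in compH minH *.
  have [c Lc le_c] := below_completion compH; exists c => //.
  by apply/esym/eqP/minH; rewrite completion_minimal.
split; first exact: completion_minimal.
apply/forall_inP => K /andP[compK le_K].
have [G eK _] := domination_completionE compK; rewrite eK in compK le_K *.
have [c' Lc' le_c'] := below_completion compK.
have le_c'c : hyp_le (D c') (D c).
  apply/dom_hyp_leP => A domA.
  by apply: (dom_hyp_leP _ _ le_K); apply: (dom_hyp_leP _ _ le_c').
rewrite -(le_minimal Lc' Lc le_c'c) in le_K *.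
by apply/eqP/dom_hyp_anti.
Qed.

Lemma dom_hyp_code_inj : {in minimal_codes &, injective (fun c => D c)}.
Proof. by move=> c c' Lc Lc' eD; apply: le_minimal; rewrite // eD hyp_le_refl. Qed.

Lemma card_min_domination_completions : #|min_domination_completions U3| = 22.
Proof.
rewrite (eq_card min_domination_completions_codes) -size_minimal_codes.
rewrite -(size_map (fun c => D c)); apply/card_uniqP.
by rewrite map_inj_in_uniq ?uniq_minimal_codes //; apply: dom_hyp_code_inj.
Qed.

Lemma minimal_codes_isomorphic (G : sgraph T) :
  isomorphic G (cycle_graph 5) \/ isomorphic G (complete_bipartite 2 3) <->
  graph_code x0 G \in minimal_codes.
Proof.
have isoC : isomorphic G (cycle_graph 5) <-> graph_code x0 G \in locked codes_C5.
  rewrite -lock.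
  apply: isomorphic_code => //.
  by case=> -[|[|[|[|[|//]]]]] i5; rewrite /vertices_C5 !inE -!val_eqE.
have isoK : isomorphic G (complete_bipartite 2 3) <-> graph_code x0 G \in locked codes_K23.
  rewrite -lock.
  apply: isomorphic_code => //.
  by case=> -[[|[|[|//]]] i5] //; rewrite /vertices_K23 !inE.
by rewrite mem_minimal_codes; split=> [[/isoC|/isoK]->|/orP[/isoC|/isoK]];
  rewrite ?orbT //; [left|right].
Qed.

(** Both sides consist of the minimal members of their up-closures, and these agree by the finite
    check. *)
Lemma pentagon_sqcap : sqcap [tuple D pentagon; D pentagram] = U3.
Proof.
rewrite sqcap_dom_hyp2; apply/setP => A; rewrite inE -minset_uniform_hyp.
apply: minset_eq => B; rewrite !(dominating_code hT x0).
rewrite !code_graph_of ?pentagon_minimal ?pentagram_minimal // -count_set_code.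
exact/eqP/((all_bitvecs5P hT x0 _) pentagon_pentagram).
Qed.

Lemma uniform_hyp3_not_domination : ~~ domination_hypergraph U3.
Proof.
apply/negP => /andP[_ /existsP[G /eqP eU]].
have /allP/(_ _ (graph_code_bitvecs x0 G))/negP := no_uniform_code.
apply; apply/(all_bitvecs5P hT x0) => A.
rewrite -dominating_code // count_set_code; apply/eqP.
by apply/dominating_dom_hypP/uniform_hypP; rewrite eU.
Qed.

Lemma decomposition_number_uniform_hyp3 : is_decomposition_number U3 2.
Proof.
split=> [|s].
  exists [tuple D pentagon; D pentagram].
  have ground c : domination_hypergraph (D c) && has_full_ground (D c).
    by rewrite has_full_ground_dom_hyp domination_hypergraph_dom_hyp ?hT.
  apply/and3P; split; last exact/eqP/pentagon_sqcap.
    rewrite /= inE andbT; apply/eqP => /dom_hyp_code_inj.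
    by move/(_ pentagon_minimal pentagram_minimal).
  by apply/allP => H; rewrite !inE => /orP[]/eqP->.
(* The meet of no hypergraphs contains the empty set, and a single hypergraph is its own meet, which
   would make [U_3] a domination hypergraph. *)
case: s => [|[|//]] Hs /and3P[_ allHs /eqP eU].
  by have := sqcap0 Hs; rewrite eU inE cards0.
move: allHs eU; case/tupleP: Hs => H Hs; rewrite (tuple0 Hs) /= andbT.
case/andP=> domH _; rewrite sqcap1; last by case/andP: domH.
by move=> eH; move: domH; rewrite eH (negPf uniform_hyp3_not_domination).
Qed.

End MinimalCompletions.

Theorem theorem4p12 (T : finType) (hT : #|T| = 5) :
  [/\ forall H : {set {set T}},
        H \in min_domination_completions (uniform_hyp 3 T) <->
        exists2 G : sgraph T,
          isomorphic G (cycle_graph 5) \/ isomorphic G (complete_bipartite 2 3)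
          & H = dom_hyp G,
      #|min_domination_completions (uniform_hyp 3 T)| = 22,
      is_decomposition_number (uniform_hyp 3 T) 2,
      exists H H' : {set {set T}},
        [/\ H \in min_domination_completions (uniform_hyp 3 T),
            H' \in min_domination_completions (uniform_hyp 3 T)
          & uniform_hyp 3 T = sqcap [tuple H; H']]
    & ~~ domination_hypergraph (uniform_hyp 3 T)].
Proof.
have /card_gt0P[x0 _] : 0 < #|T| by rewrite hT.
have minE := min_domination_completions_codes hT x0.
split.
- move=> H; rewrite minE; split=> [/mapP[c Lc ->]|[G isoG ->]].
    exists (code_graph T c) => //; apply/(minimal_codes_isomorphic hT x0).
    by rewrite code_graphK // minimal_codes_bitvecs.
  by apply/mapP; exists (graph_code x0 G);
    [apply/(minimal_codes_isomorphic hT x0)|rewrite graph_codeK].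
- exact: card_min_domination_completions hT x0.
- exact: decomposition_number_uniform_hyp3 hT x0.
- exists (dom_hyp (code_graph T pentagon)), (dom_hyp (code_graph T pentagram)).
  split; last exact/esym/pentagon_sqcap.
    by rewrite minE; apply/mapP; exists pentagon; first exact: pentagon_minimal.
  by rewrite minE; apply/mapP; exists pentagram; first exact: pentagram_minimal.
- exact: uniform_hyp3_not_domination hT x0.
Qed.
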